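(* Let $j\ge 1$ and $k\ge j$ be integers, and let $G$ be a $j$-connected $K_{1,j(k-2)+2}$-free graph. Then $G$ has a $k$-tree.
   Context: All graphs are finite, simple and undirected. A graph is $j$-connected if it has more than $j$ vertices and no deletion of fewer than $j$ vertices disconnects it. A graph is $K_{1,t}$-free if it contains no induced subgraph isomorphic to the complete bipartite graph $K_{1,t}$. A $k$-tree of a connected graph $G$ is a spanning tree $T$ of $G$ such that $d_T(v)\le k$ for all $v\in V(T)$, where $d_T(v)$ is the degree of $v$ in $T$. *)

(* Defs.v *)
From mathcomp Require Import all_boot all_order all_algebra.

Set Implicit Arguments.
Unset Strict Implicit.
Unset Printing Implicit Defensive.

Definition simple_graph (V : finType) (e : rel V) : Prop :=
  symmetric e /\ irreflexive e.

Definition graph_iso (V W : finType) (e : rel V) (h : rel W) : Prop :=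
  exists2 f : V -> W, bijective f & forall x y, h (f x) (f y) = e x y.

Definition induced (V : finType) (e : rel V) (A : {set V}) :
  rel {x : V | x \in A} := fun x y => e (val x) (val y).

Definition complete_bipartite (s t : nat) : rel ('I_s + 'I_t)%type :=
  fun x y => match x, y with
             | inl _, inr _ | inr _, inl _ => true
             | _, _ => false
             end.

Definition star_free (t : nat) (V : finType) (e : rel V) : Prop :=
  forall A : {set V}, ~ graph_iso (@induced V e A) (@complete_bipartite 1 t).

Definition connected_graph (V : finType) (e : rel V) : Prop :=
  forall x y : V, connect e x y.

Definition j_connected (j : nat) (V : finType) (e : rel V) : Prop :=
  j < #|V| /\
  forall S : {set V}, #|S| < j -> connected_graph (@induced V e (~: S)).

(* The size bound is needed because an edge xy yields the closed walk [:: x; y],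
   which satisfies [ucycle]. *)
Definition acyclic (V : finType) (e : rel V) : Prop :=
  forall c : seq V, ucycle e c -> size c < 3.

Definition tree (V : finType) (e : rel V) : Prop :=
  [/\ simple_graph e, connected_graph e & acyclic e].

Definition degree (V : finType) (e : rel V) (v : V) : nat := #|[set w | e v w]|.

(* Being a relation on the same vertex type V makes T spanning. *)
Definition k_tree (k : nat) (V : finType) (e T : rel V) : Prop :=
  [/\ tree T, subrel T e & forall v, degree T v <= k].

(* Main.v *)
Require Import Defs.
From mathcomp Require Import all_boot all_order all_algebra.
From mathcomp Require Import boolp zify.

Set Implicit Arguments.
Unset Strict Implicit.
Unset Printing Implicit Defensive.

Local Notation root := fingraph.root.

(** If k = 1 then j = t = 1, and an edge of the connected graph G is an induced
    K_{1,1}; so let k >= 2, and suppose that G has no k-tree.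

    Choose a spanning tree T0 minimizing the excess, the sum of the numbers
    max(0, d(v) - k), and allow each vertex v only degrees at most
    dhat(v) = max(k, d_T0(v)).  Trees obeying this bound are called feasible.
    Relative to a set W and a tree T, two trees are of the same kind (predicate
    kin) when they agree on pairs of W, have the same components outside W, and
    have the same adjacencies between W and these components; and a vertex is
    reducible if some feasible tree of the kind of T gives it a degree below its
    bound.

    The argument constructs W and T such that
    - no vertex of W is reducible, and every vertex outside W is;
    - no edge of G joins two distinct components of T - W;
    - if uv is an edge of T inside W, then no vertex outside W is G-adjacent to
      both u and v.
    By minimality of the excess, a vertex w with dhat(w) > k is not reducible, so
    the degrees of T sum to at least k|W| + 1 over W.  Let S1 be the set of
    vertices of W with a T-neighbour in W.  As T is a tree, T - W then has at least
    (k - 2)|W| + (|W| - |S1|) + 2 components (component_count).  Each of them has at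
    least j neighbours in W, since G is j-connected (neighbours_bound).  A vertex
    s of W is adjacent to at most t - 1 = j(k - 2) + 1 of them, one neighbour in each
    giving an induced star, and even to one fewer if s is in S1, a T-neighbour of s
    in W being a further leaf of the star (star_count).  Double counting the
    adjacencies of vertices of W with components gives
    j((k - 2)|W| + (|W| - |S1|) + 2) <= j(k - 2)|W| + (|W| - |S1|), which is absurd.

    W and T are reached from the empty set by refinement (good_refine): W is
    replaced by the set W' of all vertices that are not reducible, and T by a tree
    T1 of the same kind, relative to W, that maximizes the number of pairs of
    vertices connected in T1 - W'.  The invariant (good) says that no vertex of W is
    reducible, and gives the two statements about edges of G for reducible vertices
    x outside W only, the last one in the weaker form that x lies in the component of
    u or v.  A violation of it at W' allows an exchange of edges in a tree of the
    kind of T1.  Either the exchange makes a vertex of W' reducible, or it moves an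
    edge outside W', and then maximality of T1 compares the sizes of two components
    (transfer); two such comparisons contradict each other.  The process stops
    because W grows strictly. *)

(** * Relations, edge sets and spanning forests *)

(** Sets of ordered pairs of vertices.  A graph is encoded by a symmetric such set,
    so that each edge counts twice in its cardinal; a spanning tree is a connected
    symmetric set of at most 2(n - 1) pairs.  Naming the finite type of pairs
    explicitly makes all these sets share syntactically the same type. *)
Notation arcs V := {set Datatypes_prod__canonical__fintype_Finite V V}.

Section Relations.
Variable V : finType.
Implicit Types (R : rel V) (A B : arcs V) (W S : {set V}).

(** The set of pairs of a relation. *)
Definition pairs R : arcs V := [set p | R p.1 p.2].
(** The relation whose pairs are the elements of [A]. *)
Definition arc_rel A : rel V := fun a b => (a, b) \in A.
(** The two arcs of the undirected edge ab. *)
Definition edge a b : arcs V := [set p | (p == (a, b)) || (p == (b, a))].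
(** The component of [a], for symmetric [R]. *)
Definition component R a : {set V} := [set z | connect R a z].

Lemma edge2 a b : edge a b = [set (a, b); (b, a)].
Proof. by apply/setP => p; rewrite !inE. Qed.

Lemma arcD x y A B : ((x, y) \in A :\: B) = ((x, y) \notin B) && ((x, y) \in A).
Proof. exact: in_setD. Qed.

Lemma arcU x y A B : ((x, y) \in A :|: B) = ((x, y) \in A) || ((x, y) \in B).
Proof. exact: in_setU. Qed.

Lemma edgeE a b p : (p \in edge a b) = (p == (a, b)) || (p == (b, a)).
Proof. by rewrite inE. Qed.

Lemma edge_sym a b x y : ((x, y) \in edge a b) = ((y, x) \in edge a b).
Proof. by rewrite !edgeE !xpair_eqE; do 2!case: (x == _); do 2!case: (y == _). Qed.

Lemma edgeC a b : edge a b = edge b a.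
Proof. by apply/setP => p; rewrite !edgeE orbC. Qed.

(** In each component, a breadth-first parent of every vertex other than the chosen
    root; [d] decreases towards the root. *)
Lemma parent_function R : symmetric R ->
  exists (par : V -> V) (d : V -> nat), forall v, root R v != v ->
    [/\ R v (par v), d (par v) < d v & root R (par v) = root R v].
Proof.
move=> sR; have cR := sym_connect_sym sR.
pose P v n := [exists p : n.-tuple V, path R v p && (last v p == root R v)].
have exP v : exists n, P v n.
  case/connectP: (connect_root R v) => p pp lp.
  by exists (size p); apply/existsP; exists (in_tuple p); rewrite pp -lp eqxx.
pose d v := ex_minn (exP v).
have dw v : root R v != v ->
    exists w, [&& R v w, d w < d v & root R w == root R v].
  move=> rv; rewrite {2}/d; case: ex_minnP => n /existsP[p /andP[]] + + _.
  case: n p => [p|n p]; first by rewrite tuple0 /= eq_sym (negbTE rv).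
  case/tupleP: p => w p /= /andP[vw pp] lp; exists w; rewrite vw.
  have rw : root R w = root R v by apply/esym/(fingraph.rootP cR)/connect1.
  rewrite rw eqxx andbT /d; case: ex_minnP => m _ /(_ n); rewrite ltnS => -> //.
  by apply/existsP; exists p; rewrite pp rw lp.
exists (fun v => odflt v [pick w | [&& R v w, d w < d v & root R w == root R v]]), d.
move=> v /dw [w hw]; case: pickP => [u /and3P[-> -> /eqP ->]|/(_ w)] //.
by rewrite hw.
Qed.

(** The arcs between vertices and their parents form a spanning forest.  As each
    edge joins a vertex to its parent, the edges inside a set [S] are at most as many
    as the vertices of [S] that they meet. *)
Lemma spanning_forest R : symmetric R ->
  exists A, [/\ symmetric (arc_rel A), A \subset pairs R,
    #|A| + 2 * #|[set v | root R v == v]| = 2 * #|V|,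
    forall x y, connect R x y -> connect (arc_rel A) x y &
    forall S, #|A :&: setX S S| <=
      2 * #|[set s in S | [exists u in S, (s, u) \in A]]|].
Proof.
move=> sR; have cR := sym_connect_sym sR.
have [par [d pd]] := parent_function sR.
pose N := [set v | root R v != v].
(* The arcs from vertices to their parents, and the opposite arcs. *)
pose f v := (v, par v); pose g v := (par v, v).
have fi : injective f by move=> u v [].
have gi : injective g by move=> u v [].
have memA a b : ((a, b) \in f @: N :|: g @: N) =
    (a \in N) && (b == par a) || (b \in N) && (a == par b).
  rewrite in_setU; congr (_ || _).
    apply/imsetP/andP => [[v vN [-> ->]]|[aN /eqP ->]]; [by [] | by exists a].
  apply/imsetP/andP => [[v vN [-> ->]]|[bN /eqP ->]]; [by [] | by exists b].
have sA : symmetric (arc_rel (f @: N :|: g @: N)).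
  by move=> a b; rewrite /arc_rel !memA orbC.
exists (f @: N :|: g @: N); split => //.
- apply/subsetP => -[a b]; rewrite memA !inE => /= /orP[] /andP[/pd[h _ _] /eqP ->] //.
  by rewrite sR.
- rewrite cardsU (_ : _ :&: _ = set0) ?cards0.
    rewrite !card_imset // -(cardsC N) (_ : ~: N = [set v | root R v == v]); first by lia.
    by apply/setP => v; rewrite !inE negbK.
  apply/setP => -[a b]; rewrite !inE; apply/negP => /andP[/imsetP[u uN [-> ->]]].
  move=> /imsetP[v vN [e1 e2]]; rewrite -{}e2 {v}in vN e1 *.
  move: uN vN; rewrite !inE => /pd[_ h1 _] /pd[_ h2 _].
  by move: h1 h2; rewrite -e1; lia.
- have toroot v : connect (arc_rel (f @: N :|: g @: N)) v (root R v).
    have [n] := ubnP (d v); elim: n v => // n IH v hv.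
    have [->|rv] := eqVneq (root R v) v; first exact: connect0.
    have [h1 h2 h3] := pd v rv.
    apply: (@connect_trans _ _ (par v)).
      by apply: connect1; rewrite /arc_rel memA inE rv eqxx.
    by rewrite -h3; apply: IH; lia.
  move=> x y /(fingraph.rootP cR) exy.
  apply: connect_trans (toroot x) _.
  by rewrite exy (sym_connect_sym sA).
- move=> S; set A := _ :|: _; set S1 := [set s in _ | _].
  have -> : 2 * #|S1| = #|f @: S1| + #|g @: S1| by rewrite !card_imset //; lia.
  apply: leq_trans (subset_leq_card _) (leq_card_setU _ _).
  apply/subsetP => -[a b]; rewrite in_setI in_setX /= => /andP[ab /andP[aS bS]].
  have aS1 : a \in S1 by rewrite inE aS; apply/existsP; exists b; rewrite bS.
  have bS1 : b \in S1.
    rewrite inE bS; apply/existsP; exists a; rewrite aS.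
    by have := sA b a; rewrite /arc_rel => ->.
  move: ab; rewrite memA in_setU => /orP[] /andP[_ /eqP ->].
    by rewrite (imset_f f).
  by rewrite (imset_f g) ?orbT.
Qed.

Lemma pairs_arc_rel A : pairs (arc_rel A) = A.
Proof. by apply/setP => -[a b]; rewrite inE. Qed.

(** A graph on n vertices with c components has at least n - c edges. *)
Lemma forest_bound R : symmetric R ->
  2 * #|V| <= #|pairs R| + 2 * #|[set v | root R v == v]|.
Proof.
move=> /spanning_forest [A [_ /subset_leq_card]]; lia.
Qed.

Lemma card_roots_connected R : (forall x y, connect R x y) ->
  #|[set v | root R v == v]| <= 1.
Proof.
move=> cR; apply/card_le1P => x; rewrite inE => /eqP <- y; rewrite inE.
have sR : connect_sym R by move=> a b; rewrite !cR.
apply/eqP/eqP => [<-|->]; last by apply: root_root.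
exact/(fingraph.rootP sR).
Qed.

Lemma connected_bound A : symmetric (arc_rel A) -> (forall x y, connect (arc_rel A) x y) ->
  2 * #|V| <= #|A| + 2.
Proof.
by move=> /forest_bound + /card_roots_connected; rewrite pairs_arc_rel; lia.
Qed.

(** After the deletion of ab, everything reachable from [a] remains reachable from one
    of the two ends. *)
Lemma bridge R a b : symmetric R -> forall x, connect R a x ->
  let R0 := fun u v => R u v && ((u, v) \notin edge a b) in
  connect R0 a x \/ connect R0 b x.
Proof.
move=> sR x /connectP[p + ->] R0; elim/last_ind: p => [|p z IH] /=.
  by left; apply: connect0.
rewrite rcons_path last_rcons => /andP[/IH{}IH Rz].
have [h|h] := boolP ((last a p, z) \in edge a b).
  by move: h; rewrite !inE => /orP[] /eqP[_ ->]; [right|left]; apply: connect0.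
have h1 : connect R0 (last a p) z by apply: connect1; rewrite /R0 Rz.
by case: IH => IH; [left|right]; apply: connect_trans h1.
Qed.

(** A simple path from [v] does not come back to [v] after its first step. *)
Lemma first_step R v x : connect R v x -> v != x ->
  exists2 v1, R v v1 &
    connect (fun a b => [&& R a b, a != v & b != v]) v1 x.
Proof.
move=> /connectP[p pp ->]; case/shortenP: pp => [[|v1 q]] /=; first by rewrite eqxx.
move=> /andP[vv1 pq] /andP[nv _] _ _; exists v1 => //.
apply/connectP; exists q => //.
elim: q v1 {vv1} pq nv => //= y q IH v1 /andP[v1y pq].
rewrite inE negb_or => /andP[nv hv].
rewrite v1y IH // andbT eq_sym nv /=.
by move: hv; rewrite inE negb_or eq_sym => /andP[].
Qed.

(** If [R1] contains, up to connectivity, all of [R] but the edge xy, and joins [x] to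
    a vertex [v] of another component of [R], then replacing [R] by [R1] loses at most
    2|K|(|C(x)| - |K|) connected ordered pairs, where K is the part of the component
    C(x) that remains with [x], and gains at least 2|K||C(v)| of them. *)
Lemma transfer R R1 x y v : symmetric R -> symmetric R1 -> R x y ->
  (forall a b, R a b -> (a, b) \notin edge x y -> connect R1 a b) ->
  connect R1 x v -> ~~ connect R x v ->
  #|pairs (connect R1)| <= #|pairs (connect R)| ->
  #|component R v| < #|component R x|.
Proof.
move=> sR s1 xy h01 xv nxv hle.
have cR := sym_connect_sym sR; have c1 := sym_connect_sym s1.
pose R0 := fun u v => R u v && ((u, v) \notin edge x y).
have sR0 : symmetric R0.
  move=> a b; rewrite /R0 sR !inE !xpair_eqE; congr (_ && ~~ _).
  by do 2!case: (_ == x); do 2!case: (_ == y).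
have c0 := sym_connect_sym sR0.
have s01 a b : connect R0 a b -> connect R1 a b.
  apply: connect_sub => {}a {}b /andP[]; exact: h01.
have s0R a b : connect R0 a b -> connect R a b.
  by apply: connect_sub => {}a {}b /andP[h _]; apply: connect1.
pose K := component R0 x; pose L := component R x :\: K.
have Rnxy a b : connect R a b -> ~~ connect R x a -> connect R0 a b.
  case/connectP=> p pp ->; elim: p a pp => [|z p IH] a /=; first by rewrite connect0.
  move=> /andP[az pz] na; apply: connect_trans (IH z pz _); last first.
    by apply: contra na => h; apply: connect_trans h _; apply: connect1; rewrite sR.
  apply: connect1; rewrite /R0 az !inE !xpair_eqE negb_or /=; apply/andP; split.
    by apply: contra na => /andP[/eqP -> _]; apply: connect0.
  by apply: contra na => /andP[/eqP -> _]; apply: connect1.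
have Ly z : z \in L -> connect R0 y z.
  rewrite !inE => /andP[nz xz]; case: (bridge y sR xz) => // h.
  by rewrite -/R0 h in nz.
(* Deleting xy can only disconnect K from L, and R1 joins K to the component of v. *)
have xK : x \in K by rewrite inE connect0.
have vC : v \in component R v by rewrite inE connect0.
pose P := pairs (connect R); pose P1 := pairs (connect R1).
have lost : #|P :\: P1| <= 2 * (#|K| * #|L|).
  rewrite mul2n -addnn -{1}cardsX mulnC -cardsX.
  apply: leq_trans (subset_leq_card _) (leq_card_setU _ _).
  apply/subsetP => -[a b]; rewrite !inE /= => /andP[n1 ab].
  have n0 : ~~ connect R0 a b by apply: contra n1; apply: s01.
  have xa : connect R x a by apply: contraR n0; apply: Rnxy.
  have xb : connect R x b by apply: connect_trans ab.
  rewrite xa xb !andbT.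
  have [ka|ka] := boolP (connect R0 x a); have [kb|kb] := boolP (connect R0 x b) => //=.
    by case/negP: n0; rewrite c0 in ka; apply: connect_trans kb.
  have aL : a \in L by rewrite !inE ka xa.
  have bL : b \in L by rewrite !inE kb xb.
  by case/negP: n0; have := Ly a aL; rewrite c0 => h; apply: connect_trans h (Ly b bL).
have cardX2 (X Y : {set V}) : X :&: Y = set0 ->
    #|setX X Y :|: setX Y X| = 2 * (#|X| * #|Y|).
  move=> dXY; rewrite cardsU (_ : _ :&: _ = set0).
    by rewrite cards0 subn0 !cardsX mul2n -addnn [#|Y| * _]mulnC.
  apply/setP => -[a b]; move/setP: dXY => /(_ a); rewrite !inE /=.
  by do 2![case: (a \in _) => //=] => _; rewrite ?andbF.
have gained : 2 * (#|K| * #|component R v|) <= #|P1 :\: P|.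
  rewrite -cardX2; last first.
    apply/setP => a; rewrite !inE; apply/negP => /andP[/s0R xa va].
    by case/negP: nxv; apply: connect_trans xa _; rewrite cR.
  have key a b : connect R0 x a -> connect R v b -> connect R1 a b /\ ~~ connect R a b.
    move=> xa vb; split.
      apply: (@connect_trans _ _ x); first by rewrite c1; apply: s01.
      apply: (connect_trans xv); apply: s01; apply: Rnxy => //.
    apply: contra nxv => ab; apply: connect_trans (s0R _ _ xa) _.
    by apply: connect_trans ab _; rewrite cR.
  apply/subset_leq_card/subsetP => -[a b]; rewrite !inE /=.
  case/orP => /andP[h1 h2]; first by have [-> ->] := key _ _ h1 h2.
  by have [] := key _ _ h2 h1; rewrite c1 cR => -> ->.
have cx : #|component R x| = #|K| + #|L|.
  rewrite -(cardsID K (component R x)) (_ : component R x :&: K = K) //.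
  by apply/setIidPr/subsetP => z; rewrite !inE; apply: s0R.
have K0 : 0 < #|K| by apply/card_gt0P; exists x.
have e1 := cardsID P P1; have e2 := cardsID P1 P; rewrite setIC in e2.
move: hle; rewrite -/P -/P1 cx => hle.
have : #|K| * #|component R v| <= #|K| * #|L| by lia.
by rewrite leq_pmul2l //; lia.
Qed.
End Relations.

(** * Exchanging edges of trees *)
Section Moves.
Variable V : finType.
Implicit Types (R : rel V) (A B : arcs V) (W S : {set V}).

(** The graph [A] with the vertices of [W] deleted; they are kept as isolated vertices. *)
Definition avoid A W : rel V := fun a b => [&& a \notin W, b \notin W & (a, b) \in A].
Definition deg A v := #|[set w | (v, w) \in A]|.

Lemma sym_rem A a b : symmetric (arc_rel A) -> symmetric (arc_rel (A :\: edge a b)).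
Proof. by move=> sA x y; rewrite /arc_rel !arcD edge_sym; congr (_ && _); apply: sA. Qed.

Lemma sym_add A a b : symmetric (arc_rel A) -> symmetric (arc_rel (A :|: edge a b)).
Proof. by move=> sA x y; rewrite /arc_rel !arcU edge_sym; congr (_ || _); apply: sA. Qed.

Lemma sym_avoid A W : symmetric (arc_rel A) -> symmetric (avoid A W).
Proof.
move=> sA x y; rewrite /avoid; have := sA x y; rewrite /arc_rel => ->.
by do 2!case: (_ \in W).
Qed.

Arguments sym_avoid {A W} _.

Lemma deg_sub A B v : A \subset B -> deg A v <= deg B v.
Proof.
by move=> /subsetP AB; apply/subset_leq_card/subsetP => w; rewrite !inE => /AB.
Qed.

Lemma deg_rem A a b v : symmetric (arc_rel A) -> (a, b) \in A -> a != b ->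
  deg (A :\: edge a b) v + (v == a) + (v == b) <= deg A v.
Proof.
move=> sA ab nab.
have ba : (b, a) \in A by have := sA b a; rewrite /arc_rel ab.
have [->{v}|va] := eqVneq v a.
  rewrite (negbTE nab) addn0 addn1; apply: proper_card; apply/properP; split.
    by apply/subsetP => w; rewrite !inE => /andP[].
  by exists b; rewrite !inE // eqxx.
have [->{v va}|vb] := eqVneq v b; last first.
  by rewrite !addn0; apply/deg_sub/subsetDl.
rewrite addn0 addn1; apply: proper_card; apply/properP; split.
  by apply/subsetP => w; rewrite !inE => /andP[].
by exists a; rewrite !inE // eqxx orbT.
Qed.

Lemma deg_add A a b v : a != b ->
  deg (A :|: edge a b) v <= deg A v + (v == a) + (v == b).
Proof.
move=> nab; have [->{v}|va] := eqVneq v a.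
  rewrite (negbTE nab) addn0 addn1.
  apply: (@leq_trans #|b |: [set w | (a, w) \in A]|); last first.
    by rewrite cardsU1 /deg; case: (_ \in _) => /=; lia.
  apply/subset_leq_card/subsetP => w; rewrite !inE !xpair_eqE eqxx (negbTE nab) /= orbF.
  by rewrite orbC.
have [->{v va}|vb] := eqVneq v b.
  rewrite addn0 addn1.
  apply: (@leq_trans #|a |: [set w | (b, w) \in A]|); last first.
    by rewrite cardsU1 /deg; case: (_ \in _) => /=; lia.
  apply/subset_leq_card/subsetP => w; rewrite !inE !xpair_eqE eqxx eq_sym (negbTE nab) /=.
  by rewrite orbC.
rewrite !addn0; apply/subset_leq_card/subsetP => w.
by rewrite !inE !xpair_eqE (negbTE va) (negbTE vb) /= orbF.
Qed.

Lemma card_edge (a b : V) : #|edge a b| <= 2.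
Proof. by rewrite edge2 cards2; case: eqP. Qed.

Lemma card_rem A a b : symmetric (arc_rel A) -> (a, b) \in A -> a != b ->
  #|A :\: edge a b| + 2 = #|A|.
Proof.
move=> sA ab nab.
have ba : (b, a) \in A by have := sA b a; rewrite /arc_rel ab.
rewrite -(cardsID (edge a b) A) addnC; congr addn.
have /setIidPr -> : edge a b \subset A.
  by apply/subsetP => p; rewrite edgeE => /orP[] /eqP ->.
by rewrite edge2 cards2 xpair_eqE (negbTE nab).
Qed.

Lemma card_add A a b : #|A :|: edge a b| <= #|A| + 2.
Proof. by rewrite cardsU; have := card_edge a b; lia. Qed.

(** The ends of ab are equal or adjacent after contraction of the components of
    [B] outside [W].  Vertices of [W] being isolated in [avoid B W], this means: for
    distinct a, b in [W], that ab is in [B]; for a, b outside [W], that they are in the same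
    component; for a in [W] and b outside, that [a] has a [B]-neighbour in the component
    of [b]. *)
Definition linked W B a b :=
  connect (avoid B W) a b \/
  exists a' b', [/\ connect (avoid B W) a a', connect (avoid B W) b b' & (a', b') \in B].

(** Every edge of [A] is linked in [B]; so [B] is at least as connected as [A], seen
    from [W]. *)
Definition covers W A B := forall a b, (a, b) \in A -> linked W B a b.

Lemma linked_mem W B a b : (a, b) \in B -> linked W B a b.
Proof. by move=> ab; right; exists a, b; split=> //; apply: connect0. Qed.

Lemma covers_refl W A : covers W A A.
Proof. by move=> a b; apply: linked_mem. Qed.

Lemma linked_sym W B a b : symmetric (arc_rel B) -> linked W B a b -> linked W B b a.
Proof.
move=> sB; case=> [h|[a' [b' [h1 h2 h3]]]].
  by left; rewrite (sym_connect_sym (sym_avoid sB)).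
by right; exists b', a'; split => //; have := sB b' a'; rewrite /arc_rel h3.
Qed.

Lemma connect_avoid_in B W a b : a \in W -> connect (avoid B W) a b -> b = a.
Proof. by move=> aW /connectP[[|c p] /=]; rewrite // {1}/avoid aW. Qed.

Lemma connect_avoid_out B W a b : a \notin W -> connect (avoid B W) a b -> b \notin W.
Proof.
move=> aW /connectP[p + ->]; elim: p a aW => //= c p IH a _ /andP[/and3P[_ cW _]].
exact: IH.
Qed.

Lemma linked_in W B a b : a \in W -> b \in W -> a != b -> linked W B a b -> (a, b) \in B.
Proof.
move=> aW bW nab [/(connect_avoid_in aW) eab|[a' [b' [h1 h2 h3]]]].
  by rewrite eab eqxx in nab.
by rewrite -(connect_avoid_in aW h1) -(connect_avoid_in bW h2).
Qed.

Lemma linked_out W B a b : symmetric (arc_rel B) ->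
  a \notin W -> b \notin W -> linked W B a b -> connect (avoid B W) a b.
Proof.
move=> sB aW bW [//|[a' [b' [h1 h2 h3]]]]; apply: (connect_trans h1).
apply: (@connect_trans _ _ b'); last by rewrite (sym_connect_sym (sym_avoid sB)).
by apply: connect1; rewrite /avoid h3 (connect_avoid_out aW h1) (connect_avoid_out bW h2).
Qed.

Lemma linked_inout W B a b : a \in W -> b \notin W -> linked W B a b ->
  exists2 b', connect (avoid B W) b b' & (a, b') \in B.
Proof.
move=> aW bW [/(connect_avoid_in aW) eab|[a' [b' [h1 h2 h3]]]].
  by rewrite eab aW in bW.
by exists b'; rewrite // -(connect_avoid_in aW h1).
Qed.

Lemma covers_connect W A B : symmetric (arc_rel B) -> covers W A B ->
  forall a b, connect (avoid A W) a b -> connect (avoid B W) a b.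
Proof.
move=> sB h a b; apply: connect_sub => {}a {}b /and3P[aW bW /h].
exact: linked_out.
Qed.

Lemma covers_trans W A B C : symmetric (arc_rel B) -> symmetric (arc_rel C) ->
  covers W A B -> covers W B C -> covers W A C.
Proof.
move=> sB sC hAB hBC a b /hAB[h|[a' [b' [h1 h2 h3]]]].
  by left; apply: covers_connect h.
have h1' := covers_connect sC hBC h1; have h2' := covers_connect sC hBC h2.
have cC := sym_connect_sym (sym_avoid (W := W) sC).
have [h4|[a'' [b'' [h4 h5 h6]]]] := hBC _ _ h3.
  by left; apply: connect_trans h1' (connect_trans h4 _); rewrite cC.
by right; exists a'', b''; split => //; [apply: connect_trans h4 | apply: connect_trans h5].
Qed.

Lemma connect_avoid_mono A W W' a b : W \subset W' ->
  connect (avoid A W') a b -> connect (avoid A W) a b.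
Proof.
move=> /subsetP WW; apply: connect_sub => {}a {}b /and3P[aW bW ab].
apply: connect1; rewrite /avoid ab andbT; apply/andP; split.
  by apply: contra aW; apply: WW.
by apply: contra bW; apply: WW.
Qed.

Lemma covers_mono W W' A B : W \subset W' -> covers W' A B -> covers W A B.
Proof.
move=> WW h a b /h[h1|[a' [b' [h1 h2 h3]]]].
  by left; apply: connect_avoid_mono h1.
by right; exists a', b'; split => //; apply: connect_avoid_mono WW _.
Qed.

Lemma connect_avoid_arc_rel A W a b : connect (avoid A W) a b -> connect (arc_rel A) a b.
Proof. by apply: connect_sub => {}a {}b /and3P[_ _ ab]; apply: connect1. Qed.

Lemma covers_connected W A B : symmetric (arc_rel B) -> covers W A B ->
  (forall x y, connect (arc_rel A) x y) -> forall x y, connect (arc_rel B) x y.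
Proof.
move=> sB h cA x y; have := cA x y; apply: connect_sub => {}x {}y /h.
case=> [|[a' [b' [/connect_avoid_arc_rel h1 /connect_avoid_arc_rel h2 h3]]]].
  exact: connect_avoid_arc_rel.
apply: connect_trans h1 (connect_trans (connect1 h3) _).
by rewrite (sym_connect_sym sB).
Qed.

(** It suffices to test the edges that are deleted. *)
Lemma covers_swap W A B a b : symmetric (arc_rel B) ->
  A :\: edge a b \subset B -> linked W B a b -> covers W A B.
Proof.
move=> sB /subsetP AB h u v uv; have [|uvab] := boolP ((u, v) \in edge a b).
  by rewrite edgeE => /orP[] /eqP[-> ->] //; apply: linked_sym.
by apply/linked_mem/AB; rewrite arcD uvab.
Qed.

Lemma covers_swap2 W A B a b c d : symmetric (arc_rel B) ->
  (A :\: edge a b) :\: edge c d \subset B -> linked W B a b -> linked W B c d ->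
  covers W A B.
Proof.
move=> sB /subsetP AB h1 h2 u v uv; have [|uvab] := boolP ((u, v) \in edge a b).
  by rewrite edgeE => /orP[] /eqP[-> ->] //; apply: linked_sym.
have [|uvcd] := boolP ((u, v) \in edge c d).
  by rewrite edgeE => /orP[] /eqP[-> ->] //; apply: linked_sym.
by apply/linked_mem/AB; rewrite !arcD uvab uvcd.
Qed.

(** Here [e] is the ambient graph, and [dhat] bounds the degrees of the trees. *)
Variables (e : rel V) (dhat : V -> nat).
Hypotheses (se : symmetric e) (ie : irreflexive e).

(** Spanning trees of [e] with degrees at most [dhat]; a connected set of at most
    2(n - 1) arcs is a tree. *)
Definition feasible A := [/\ symmetric (arc_rel A), A \subset pairs e,
  (forall x y, connect (arc_rel A) x y), #|A| + 2 <= 2 * #|V| &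
  forall v, deg A v <= dhat v].

(** [A] is a feasible tree of the same kind as [T] relative to [W]: both have the same
    edges in [W], the same components outside [W] and the same adjacencies between
    these and [W]. *)
Definition kin W T A := [/\ feasible A, covers W T A & covers W A T].

(** Some tree of the kind of [T] does not reach the degree bound at [x]. *)
Definition reducible W T x := exists2 A, kin W T A & deg A x < dhat x.

Lemma feasible_sym A : feasible A -> symmetric (arc_rel A). Proof. by case. Qed.
Lemma kin_feasible W T A : kin W T A -> feasible A. Proof. by case. Qed.

Lemma feasibleC A a b : feasible A -> ((a, b) \in A) = ((b, a) \in A).
Proof. by move=> /feasible_sym sA; apply: sA. Qed.

Lemma feasible_neq A a b : feasible A -> (a, b) \in A -> a != b.
Proof.
case=> _ /subsetP h _ _ _ /h; rewrite inE /= => ab.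
by apply: contraTneq ab => ->; rewrite ie.
Qed.

Lemma kin_refl W T : feasible T -> kin W T T.
Proof. by move=> fT; split => //; apply: covers_refl. Qed.

Lemma kin_trans W T A B : feasible T -> kin W T A -> kin W A B -> kin W T B.
Proof.
move=> fT [fA h1 h2] [fB h3 h4]; split => //.
  exact: (covers_trans (feasible_sym fA) (feasible_sym fB) h1 h3).
exact: (covers_trans (feasible_sym fA) (feasible_sym fT) h4 h2).
Qed.

Lemma kin_mono W W' T A : W \subset W' -> kin W' T A -> kin W T A.
Proof. by move=> WW [fA h1 h2]; split => //; apply: covers_mono WW _. Qed.

Lemma kin_connect W T A a b : feasible T -> kin W T A ->
  connect (avoid A W) a b = connect (avoid T W) a b.
Proof.
move=> fT [fA h1 h2]; apply/idP/idP; first exact: covers_connect (feasible_sym fT) h2 _ _.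
exact: covers_connect (feasible_sym fA) h1 _ _.
Qed.

Lemma avoidC A W a b : feasible A -> connect (avoid A W) a b = connect (avoid A W) b a.
Proof. by move=> /feasible_sym sA; apply/sym_connect_sym/sym_avoid. Qed.

(** The exchange of ab for ax, at a vertex [x] with spare degree, only increases the
    degree of [x], and makes [b] reducible. *)
Lemma kin_swap W T A a b x : feasible T -> kin W T A -> (a, b) \in A -> e a x -> b != x ->
  deg A x < dhat x -> let A' := (A :\: edge a b) :|: edge a x in
  linked W A' a b -> linked W A a x -> kin W T A' /\ deg A' b < dhat b.
Proof.
move=> fT kA ab ax nbx hx A' lk1 lk2; have fA := kin_feasible kA.
have [sA /subsetP Ae cA cardA degA] := fA.
have nab := feasible_neq fA ab.
have nax : a != x by apply: contraTneq ax => <-; rewrite ie.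
have sA' : symmetric (arc_rel A') by apply/sym_add/sym_rem.
have hA' : covers W A A' by apply: (@covers_swap _ _ _ a b) => //; apply: subsetUl.
have dA' v : deg A' v + (v == b) <= deg A v + (v == x).
  have := @deg_add (A :\: edge a b) a x v nax; have := deg_rem v sA ab nab.
  by rewrite -/A'; lia.
split; last first.
  by have := dA' b; rewrite eqxx (negbTE nbx); have := degA b; lia.
apply: kin_trans fT kA _; split => //; last first.
  apply: (@covers_swap _ _ _ a x) => //.
  apply/subsetP => -[p q]; rewrite arcD arcU => /andP[/negbTE ->].
  by rewrite orbF arcD => /andP[].
split => //.
- apply/subsetP => -[p q]; rewrite arcU arcD => /orP[/andP[_ /Ae] //|]; rewrite edgeE.
  by case/orP=> /eqP ->; rewrite inE //= se.
- exact: covers_connected sA' hA' cA.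
- by have := card_add (A :\: edge a b) a x; have := card_rem sA ab nab; rewrite -/A'; lia.
- move=> v; have := dA' v; have [->|_] := eqVneq v x; first lia.
  by have := degA v; lia.
Qed.

(** A vertex of [W] has at most one neighbour in each component outside [W], because a
    tree has no cycle: otherwise an edge could be deleted without disconnecting it. *)
Lemma feasible_uniq_nbr W A w a b : feasible A -> w \in W -> (w, a) \in A -> (w, b) \in A ->
  connect (avoid A W) a b -> a = b.
Proof.
move=> fA wW wa wb ab; apply/eqP/negPn/negP => nab.
have [sA _ cA cardA _] := fA.
have sB := @sym_rem _ w a sA.
have hB : covers W A (A :\: edge w a).
  apply: (covers_swap sB (subxx _)); right; exists w, b; split; first exact: connect0.
    apply: connect_sub ab => u v /and3P[uW vW uv]; apply: connect1.
    rewrite /avoid uW vW arcD uv andbT edgeE !xpair_eqE negb_or /=.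
    by apply/andP; split; apply/negP => /andP[/eqP h1 /eqP h2];
      move: uW vW; rewrite h1 h2 wW.
  rewrite arcD wb andbT edgeE !xpair_eqE eqxx negb_or /= eq_sym nab /=.
  by apply: contra (feasible_neq fA wb) => /andP[_ /eqP ->].
have := connected_bound sB (covers_connected sB hB cA).
by have := card_rem sA wa (feasible_neq fA wa); lia.
Qed.

(** The arcs of [B] that meet [C], and the arcs of [A] that do not. *)
Definition splice (C : {set V}) A B : arcs V :=
  [set p | if (p.1 \in C) || (p.2 \in C) then p \in B else p \in A].

(** Trees of the same kind can be spliced along a component [C] outside [W].  The
    splice of [A] and [B] and that of [B] and [A] are both connected, hence have at least
    2(n - 1) arcs each; as together they have as many arcs as [A] and [B], both are trees.
    The degree at a vertex of [W] does not exceed its degree in [A], as each of [A] and [B]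
    has at most one edge between it and [C], and both have one as soon as one has. *)
Lemma kin_splice W A B x : feasible A -> x \notin W -> kin W A B ->
  kin W A (splice (component (avoid A W) x) A B) /\
  forall v, v \in component (avoid A W) x ->
    deg (splice (component (avoid A W) x) A B) v = deg B v.
Proof.
move=> fA xW kB; set C := component _ _; have fB := kin_feasible kB.
have [sA Ae cA cardA degA] := fA; have [sB Be cB cardB degB] := fB.
have CW z : z \in C -> z \notin W by rewrite inE; apply: connect_avoid_out.
have CA a b : a \in C -> connect (avoid A W) a b -> b \in C.
  by rewrite !inE; apply: connect_trans.
have CC a b : a \in C -> b \in C -> connect (avoid A W) a b.
  by rewrite !inE avoidC // => ax xb; apply: connect_trans xb.
have CB a b : a \in C -> connect (avoid B W) a b -> b \in C.
  by rewrite (kin_connect _ _ fA kB); apply: CA.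
clearbody C.
have nbA a b : a \in C -> (a, b) \in A -> b \notin C -> b \in W.
  move=> aC ab; apply: contraR => bW; apply: (CA _ _ aC); apply: connect1.
  by rewrite /avoid bW CW.
have nbB a b : a \in C -> (a, b) \in B -> b \notin C -> b \in W.
  move=> aC ab; apply: contraR => bW; apply: (CB _ _ aC); apply: connect1.
  by rewrite /avoid bW CW.
(* Stated for [A1] and [B1], as it serves for the splices in both orders. *)
have key (A1 B1 : arcs V) : feasible A1 -> feasible B1 ->
    covers W A1 B1 -> covers W B1 A1 ->
    (forall a b, a \in C -> connect (avoid B1 W) a b -> b \in C) ->
    (forall a b, a \in C -> (a, b) \in A1 -> b \notin C -> b \in W) ->
    let S := splice C A1 B1 in
    [/\ symmetric (arc_rel S), covers W A1 S, covers W S A1 &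
        forall x y, connect (arc_rel S) x y].
  move=> fA1 fB1 h1 h2 CB1 nb1 S.
  have sS : symmetric (arc_rel S).
    by move=> a b; rewrite /arc_rel !inE /= orbC (feasibleC a b fA1) (feasibleC a b fB1).
  have cS a b : a \in C -> connect (avoid B1 W) a b -> connect (avoid S W) a b.
    move=> aC /connectP[p + ->]; elim: p a aC => [|z p IH] a aC /=.
      by rewrite connect0.
    move=> /andP[az pz]; have zC := CB1 _ _ aC (connect1 az).
    apply: connect_trans (IH z zC pz); apply: connect1.
    by case/and3P: az => h3 h4 h5; rewrite /avoid h3 h4 inE /= aC.
  have main a b : a \in C -> (a, b) \in A1 -> linked W S a b.
    move=> aC ab; have [h3|[a' [b' [h3 h4 h5]]]] := h1 _ _ ab; first by left; apply: cS.
    right; exists a', b'; split; [exact: cS | | by rewrite inE /= (CB1 _ _ aC h3)].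
    have [bC|bC] := boolP (b \in C); first exact: cS.
    by rewrite (connect_avoid_in (nb1 _ _ aC ab bC) h4) connect0.
  have hS : covers W A1 S.
    move=> a b ab; have [aC|aC] := boolP (a \in C); first exact: main.
    have [bC|bC] := boolP (b \in C).
      by apply: (linked_sym sS); apply: (main _ _ bC); rewrite (feasibleC _ _ fA1).
    by apply: linked_mem; rewrite inE /= (negbTE aC) (negbTE bC).
  split => //; last by apply: covers_connected sS hS _; case: fA1.
  by move=> a b; rewrite inE /=; case: ifP => _; [apply: h2 | apply: linked_mem].
have [_ hAB hBA] := kB.
have [sS h1 h2 cS] := key A B fA fB hAB hBA CB nbA.
have [sS' _ _ cS'] := key B A fB fA hBA hAB CA nbB.
set S := splice C A B in sS h1 h2 cS *; pose S' := splice C B A.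
have degC v : v \in C -> deg S v = deg B v.
  by move=> vC; apply: eq_card => w; rewrite !inE /= vC.
split => //; split => //; split => //.
- apply/subsetP => p; rewrite inE; case: ifP => _; apply/subsetP => //.
- have : #|S| + #|S'| = #|A| + #|B|.
    pose Q : arcs V := [set p | (p.1 \in C) || (p.2 \in C)].
    rewrite -(cardsID Q S) -(cardsID Q S') -(cardsID Q A) -(cardsID Q B).
    have -> : S :&: Q = B :&: Q.
      by apply/setP => p; rewrite !inE; case: (_ || _); rewrite ?andbF.
    have -> : S :\: Q = A :\: Q.
      by apply/setP => p; rewrite !inE; case: (_ || _).
    have -> : S' :&: Q = A :&: Q.
      by apply/setP => p; rewrite !inE; case: (_ || _); rewrite ?andbF.
    have -> : S' :\: Q = B :\: Q.
      by apply/setP => p; rewrite !inE; case: (_ || _).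
    lia.
  by have := connected_bound sS' cS'; rewrite -/S'; lia.
- move=> v; have [vC|vC] := boolP (v \in C); first by rewrite degC.
  apply: leq_trans (degA v).
  pose nb (X : arcs V) := [set w | (v, w) \in X].
  have e1 := cardsID C (nb S); have e2 := cardsID C (nb A).
  rewrite /deg -/(nb S) -/(nb A) -e1 -e2; apply: leq_add; last first.
    apply/subset_leq_card/subsetP => w.
    by rewrite !inE /= (negbTE vC) => /andP[/negbTE ->] /= ->.
  have -> : nb S :&: C = nb B :&: C.
    by apply/setP => w; rewrite !inE /= (negbTE vC) /=; case: (w \in C); rewrite ?andbF.
  have [->|[y]] := set_0Vmem (nb B :&: C); first by rewrite cards0.
  rewrite in_setI [y \in nb B]inE => /andP[vy yC].
  have vW : v \in W by apply: nbB yC _ vC; rewrite (feasibleC _ _ fB).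
  have -> : nb B :&: C = [set y].
    apply/setP => z; rewrite in_setI inE inE; apply/andP/eqP => [[vz zC]|-> //].
    apply: (feasible_uniq_nbr fB vW vz vy); rewrite (kin_connect _ _ fA kB).
    exact: CC.
  rewrite cards1; apply/card_gt0P.
  have [y' h3 h4] := linked_inout vW (CW _ yC) (hBA _ _ vy).
  by exists y'; rewrite in_setI inE h4 (CA _ _ yC).
Qed.
End Moves.

(** * Refinement *)
Section Step.
Variables (V : finType) (e : rel V) (dhat : V -> nat).
Hypotheses (se : symmetric e) (ie : irreflexive e).
Implicit Types (A B T : arcs V) (W : {set V}).
Local Notation kin := (kin e dhat).
Local Notation reducible := (reducible e dhat).
Local Notation feasible := (feasible e dhat).

(** The invariant: a feasible tree [T] and a set [W] of vertices, none of them
    reducible, such that edges between reducible vertices outside [W] join vertices of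
    the same component of T - W, and the common neighbours of the ends of an
    edge of a tree of the kind of [T], if reducible and outside [W], are in the component
    of one of the two ends. *)
Definition good W T := [/\ feasible T,
  (forall w, w \in W -> ~ reducible W T w),
  (forall x y, x \notin W -> y \notin W -> e x y -> reducible W T x -> reducible W T y ->
     connect (avoid T W) x y) &
  (forall A u v x, kin W T A -> (u, v) \in A -> e x u -> e x v -> x \notin W ->
     reducible W T x -> connect (avoid T W) x u \/ connect (avoid T W) x v)].

Definition num_connected_pairs W A := #|pairs (connect (avoid A W))|.

Lemma exists_max (P : arcs V -> Prop) (f : arcs V -> nat) A0 : P A0 ->
  exists2 A, P A & forall B, P B -> f B <= f A.
Proof.
move=> PA0; have hP : `[<P A0>] by apply/asboolP.
case: (@arg_maxnP _ A0 (fun A => `[<P A>]) f hP) => A /asboolP PA hA; exists A => // B PB.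
by apply: hA; apply/asboolP.
Qed.

(** One step of the refinement.  [W'] is the set of vertices that are not reducible
    relative to [W], and [T1] is a tree of the kind of [T] with the largest number of
    connected pairs outside [W']. *)
Section Refine.
Variables (W : {set V}) (T : arcs V).
Hypothesis gT : good W T.
Let W' := [set v | ~~ `[<reducible W T v>]].
Variable T1 : arcs V.
Hypothesis kT1 : kin W T T1.
Hypothesis maxT1 : forall A, kin W T A ->
  num_connected_pairs W' A <= num_connected_pairs W' T1.

Let fT : feasible T. Proof. by case: gT. Qed.
Let fT1 : feasible T1. Proof. by case: kT1. Qed.

Let WW' : W \subset W'.
Proof.
apply/subsetP => w wW; rewrite inE; apply/negP => /asboolP.
by case: gT => _ h _ _; apply: h.
Qed.

Let W'W x : x \notin W' -> x \notin W.
Proof. by apply: contra; apply: (subsetP WW'). Qed.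

Let redP v : reflect (reducible W T v) (v \notin W').
Proof. by rewrite inE negbK; apply: asboolP. Qed.

Let kinW A : kin W' T1 A -> kin W T A.
Proof. by move=> kA; apply: kin_trans kT1 (kin_mono WW' kA). Qed.

Let red'_red x : reducible W' T1 x -> reducible W T x.
Proof. by case=> A /kinW kA hx; exists A. Qed.

Let conn A a b : kin W' T1 A -> connect (avoid A W') a b = connect (avoid T1 W') a b.
Proof. exact: kin_connect. Qed.

Let npairsE A : kin W' T1 A -> num_connected_pairs W' A = num_connected_pairs W' T1.
Proof. by move=> kA; apply: eq_card => p; rewrite !inE conn. Qed.

Let componentE A x : kin W' T1 A -> component (avoid A W') x = component (avoid T1 W') x.
Proof. by move=> kA; apply/setP => p; rewrite !inE conn. Qed.

Let sym_feasible_avoid A X : feasible A -> symmetric (avoid A X).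
Proof. by move=> fA; apply/sym_avoid/feasible_sym/fA. Qed.

(** Let [v1] be the first vertex on the path from [v] to [x] in a tree of the kind of [T1]
    with spare degree at [x].  The exchange of v v1 for vx makes [v1] reducible,
    so [v1] is outside [W'], and [transfer] applies. *)
Let component_lt v x : v \notin W' -> x \notin W' -> connect (avoid T W) v x ->
  ~~ connect (avoid T1 W') v x -> e v x -> reducible W' T1 x ->
  #|component (avoid T1 W') x| < #|component (avoid T1 W') v|.
Proof.
move=> vW' xW' vx nvx evx [Tx kTx hx].
have kx := kinW kTx; have fx := kin_feasible kx.
have vW := W'W vW'; have xW := W'W xW'.
have nvx' : v != x by apply: contraTneq evx => ->; rewrite ie.
have vx' : connect (avoid Tx W) v x by rewrite (kin_connect _ _ fT kx).
have [v1 /and3P[_ v1W vv1] v1x] := first_step vx' nvx'.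
have nv1x : v1 != x.
  apply: contra nvx => /eqP ev; rewrite -(conn _ _ kTx); apply: connect1.
  by rewrite /avoid vW' xW' -ev.
set T2 := (Tx :\: edge v v1) :|: edge v x.
have v1x2 : connect (avoid T2 W) v1 x.
  apply: connect_sub v1x => a b /and3P[/and3P[aW bW ab] av bv].
  apply: connect1; rewrite /avoid aW bW arcU arcD ab edgeE !xpair_eqE.
  by rewrite (negbTE av) (negbTE bv) andbF.
have vxT2 : (v, x) \in T2 by rewrite arcU [X in _ || X]edgeE eqxx orbT.
have [k2 d2] : kin W T T2 /\ deg T2 v1 < dhat v1.
  apply: kin_swap => //.
    right; exists v, x; split => //; exact: connect0.
  by left.
have v1W' : v1 \notin W' by apply/redP; exists T2.
have := @transfer _ (avoid Tx W') (avoid T2 W') v v1 x.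
rewrite !(componentE _ kTx) (conn _ _ kTx) =>  tr; apply: tr => //.
- exact: sym_feasible_avoid.
- exact/sym_feasible_avoid/(kin_feasible k2).
- by rewrite /avoid vW' v1W'.
- move=> a b /and3P[aW bW ab] nab; apply: connect1.
  by rewrite /avoid aW bW arcU arcD ab nab.
- by apply: connect1; rewrite /avoid vW' xW'.
- by apply: leq_trans (maxT1 k2) _; rewrite -(npairsE kTx).
Qed.

(** Otherwise [component_lt] would apply to xy in both directions. *)
Let cross' x y : x \notin W' -> y \notin W' -> e x y ->
  reducible W' T1 x -> reducible W' T1 y ->
  connect (avoid T1 W') x y.
Proof.
move=> xW' yW' exy rx ry; apply/negPn/negP => nxy.
have xy : connect (avoid T W) x y.
  by case: gT => _ _ h _; apply: h => //; rewrite ?W'W //; apply: red'_red.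
have h1 := component_lt xW' yW' xy nxy exy ry.
have := @component_lt y x yW' xW'; rewrite (avoidC _ _ _ fT) xy (avoidC _ _ _ fT1) se.
by move=> /(_ isT nxy exy rx); lia.
Qed.

(** Splicing along the component of [x] gives a tree S of the kind of [T1] that
    contains uv and has spare degree at [x].  If xu is an edge of S, then [u] is in
    [W'], but the exchange of uv for vx makes it reducible.  Otherwise let [y] be the
    first vertex on the path of S from [x] to [v]; the exchange of uv and xy for xu and
    xv makes [y] reducible, so that [transfer] makes the component of [v] smaller than
    that of [x], contrary to [component_lt]. *)
Let tri_out A u v x : kin W' T1 A -> (u, v) \in A -> e x u -> e x v ->
  x \notin W' -> v \notin W' -> reducible W' T1 x -> connect (avoid T W) x v ->
  ~~ connect (avoid T1 W') x v -> ~~ connect (avoid T1 W') x u -> False.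
Proof.
move=> kA uvA exu exv xW' vW' [Tx kTx hx] xv nxv nxu.
have fA := kin_feasible kA; have kAT : kin W' A Tx.
  apply: kin_trans fA _ kTx; case: kA => _ h1 h2; split => //; exact: fT1.
have := kin_splice ie fA xW' kAT; set C := component _ _; set S := splice C A Tx.
case=> kAS degS.
have kS' : kin W' T1 S by apply: kin_trans fT1 kA kAS.
have kS := kinW kS'; have fS := kin_feasible kS.
have xC : x \in C by rewrite inE connect0.
have dSx : deg S x < dhat x by rewrite degS.
have CE z : (z \in C) = connect (avoid T1 W') x z by rewrite inE conn.
have uv : (u, v) \in S by rewrite inE /= !CE (negbTE nxu) (negbTE nxv).
have vu : (v, u) \in S by rewrite (feasibleC _ _ fS).
have xW := W'W xW'; have vW := W'W vW'.
have nxu' : x != u by apply: contraTneq exu => <-; rewrite ie.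
have nxv' : x != v by apply: contraTneq exv => <-; rewrite ie.
have nuv := feasible_neq ie fS uv.
have [xu|xu] := boolP ((x, u) \in S).
  have uW' : u \in W'.
    apply: contraR nxu => uW'; rewrite -(conn _ _ kS'); apply: connect1.
    by rewrite /avoid xW' uW'.
  have [||||k d] := @kin_swap _ e dhat se ie W T S v u x fT kS vu _ _ dSx.
  - by rewrite se.
  - by rewrite eq_sym.
  - right; exists x, u; split; last 1 first.
    + by rewrite arcU arcD xu edgeE !xpair_eqE (negbTE nxv') (negbTE nxu').
    + apply: connect1; rewrite /avoid vW xW arcU [X in _ || X]edgeE eqxx orbT.
      by [].
    + exact: connect0.
  - by left; rewrite (kin_connect _ _ fT kS) (avoidC _ _ _ fT).
  by move: uW'; apply/negP/redP; eexists; eauto.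
have xvS : connect (avoid S W) x v by rewrite (kin_connect _ _ fT kS).
have [y /and3P[_ yW xy] yv] := first_step xvS nxv'.
have nyv : y != v.
  apply: contra nxv => /eqP ev; rewrite -(conn _ _ kS'); apply: connect1.
  by rewrite /avoid xW' vW' -ev.
have nyu : y != u by apply: contra xu => /eqP <-.
have nxy := feasible_neq ie fS xy.
pose T3 := (((S :\: edge u v) :\: edge x y) :|: edge x u) :|: edge x v.
have sS := feasible_sym fS.
have s3 : symmetric (arc_rel T3) by do 2!apply: sym_add; do 2!apply: sym_rem.
have memT3 a b : (a, b) \in S -> (a, b) \notin edge u v -> (a, b) \notin edge x y ->
    (a, b) \in T3.
  by move=> h1 h2 h3; rewrite !arcU !arcD h1 h2 h3.
have xuT3 : (x, u) \in T3 by rewrite 2!arcU [in X in _ || X || _]edgeE eqxx orbT.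
have xvT3 : (x, v) \in T3 by rewrite arcU [X in _ || X]edgeE eqxx orbT.
have c3 X := sym_connect_sym (@sym_avoid _ T3 X s3).
have xv3 : connect (avoid T3 W) x v by apply: connect1; rewrite /avoid xW vW.
(* The path from [v] to [y] may have used uv; the edge xu then replaces it. *)
have xy3 : connect (avoid T3 W) x y.
  pose R : rel V := fun a b => [&& avoid S W a b, a != x & b != x].
  have sR : symmetric R.
    move=> a b; rewrite /R (sym_feasible_avoid _ fS).
    by case: (avoid _ _ _ _) => //=; rewrite andbC.
  have vy : connect R v y by rewrite (sym_connect_sym sR).
  have hR a b : R a b && ((a, b) \notin edge v u) -> connect (avoid T3 W) a b.
    move=> /andP[/and3P[/and3P[aW bW ab] ax bx] nab]; apply: connect1.
    rewrite /avoid aW bW memT3 //; first by rewrite edgeC.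
    by rewrite edgeE !xpair_eqE (negbTE ax) (negbTE bx) andbF.
  case: (bridge u sR vy) => /(connect_sub hR) h.
    exact: connect_trans xv3 h.
  have uW : u \notin W.
    by apply: contra nyu => uW; rewrite (connect_avoid_in uW h).
  by apply: connect_trans h; apply: connect1; rewrite /avoid xW uW.
have lkuv : linked W T3 u v.
  right; exists u, x; split; rewrite ?connect0 1?c3 //.
  by have := s3 u x; rewrite /arc_rel => ->.
have h3 : covers W S T3.
  apply: (@covers_swap2 _ _ _ _ u v x y) => //; last by left.
  by rewrite /T3 -!setUA subsetUl.
have h3' : covers W T3 S.
  apply: (@covers_swap2 _ _ _ _ x v x u) => //; last 1 first.
  - right; exists v, u; split => //; exact: connect0.
  - apply/subsetP => -[a b]; rewrite !arcD !arcU !arcD.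
    by case: (_ \in edge x u); case: (_ \in edge x v) => //=; rewrite !orbF => /and3P[].
  - by left.
have d3 z : deg T3 z + (z == y) <= deg S z + (z == x).
  have e1 : deg T3 z <= _ := deg_add _ z nxv'.
  have e2 := deg_add ((S :\: edge u v) :\: edge x y) z nxu'.
  have e3 := deg_rem z sS uv nuv.
  have e4 : deg ((S :\: edge u v) :\: edge x y) z + (z == x) + (z == y)
      <= deg (S :\: edge u v) z.
    apply: deg_rem => //; first exact: sym_rem.
    by rewrite arcD xy edgeE !xpair_eqE (negbTE nxu') (negbTE nxv').
  by clear -e1 e2 e3 e4; lia.
have k3 : kin W T T3.
  apply: kin_trans fT kS _; split => //; have [_ /subsetP Se cS cardS dS] := fS.
  split => //.
  - apply/subsetP => -[a b]; rewrite !arcU !arcD => /orP[/orP[/and3P[_ _ /Se] //|]|].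
      by rewrite edgeE => /orP[] /eqP[-> ->]; rewrite inE //= se.
    by rewrite edgeE => /orP[] /eqP[-> ->]; rewrite inE //= se.
  - exact: covers_connected s3 h3 cS.
  - have e1 : #|T3| <= _ := card_add _ x v.
    have e2 := card_add ((S :\: edge u v) :\: edge x y) x u.
    have e3 := card_rem sS uv nuv.
    have e4 : #|(S :\: edge u v) :\: edge x y| + 2 = #|S :\: edge u v|.
      apply: card_rem => //; first exact: sym_rem.
      by rewrite arcD xy edgeE !xpair_eqE (negbTE nxu') (negbTE nxv').
    by clear -e1 e2 e3 e4 cardS; lia.
  - move=> z; move: (d3 z) (dS z); have [->|_] := eqVneq z x.
      by move: dSx; clear; lia.
    by clear; lia.
have yW' : y \notin W'.
  apply/redP; exists T3 => //; have := d3 y; rewrite eqxx eq_sym (negbTE nxy).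
  by have [_ _ _ _ /(_ y)] := fS; clear; lia.
have lt1 : #|component (avoid T1 W') v| < #|component (avoid T1 W') x|.
  have := @transfer _ (avoid S W') (avoid T3 W') x y v.
  rewrite !(componentE _ kS') (conn _ _ kS') => tr; apply: tr => //.
  - exact: sym_feasible_avoid.
  - exact/sym_avoid.
  - by rewrite /avoid xW' yW'.
  - move=> a b /and3P[aW bW ab] nab.
    have [|nuv'] := boolP ((a, b) \in edge u v); last first.
      by apply: connect1; rewrite /avoid aW bW memT3.
    have key : u \notin W' -> connect (avoid T3 W') u v.
      move=> uW'; apply: (@connect_trans _ _ x); last first.
        by apply: connect1; rewrite /avoid xW' vW'.
      by rewrite c3; apply: connect1; rewrite /avoid xW' uW'.
    rewrite edgeE => /orP[] /eqP[ea eb]; first by rewrite ea eb key // -ea.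
    by rewrite ea eb c3 key // -eb.
  - by apply: connect1; rewrite /avoid xW' vW'.
  - by apply: leq_trans (maxT1 k3) _; rewrite -(npairsE kS').
have := @component_lt v x vW' xW'; rewrite (avoidC _ _ _ fT) xv (avoidC _ _ _ fT1) se.
move=> /(_ isT nxv exv); have rx : reducible W' T1 x by exists Tx.
by move=> /(_ rx); move: lt1; clear; lia.
Qed.

(** Without uv, the vertex [x] remains connected to [v] or to [u]; so the exchange of uv
    for ux, respectively for vx, gives a tree, in which [v], respectively [u], has lost an
    edge. *)
Let tri_in u v x Tx : kin W' T1 Tx -> deg Tx x < dhat x -> (u, v) \in Tx ->
  e x u -> e x v -> u \in W' -> v \in W' -> x \notin W' -> connect (avoid T W) x v -> False.
Proof.
move=> kTx hx uv exu exv uW' vW' xW' xv.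
have kx := kinW kTx; have fx := kin_feasible kx; have xW := W'W xW'.
have vu : (v, u) \in Tx by rewrite (feasibleC _ _ fx).
have vxT : connect (avoid Tx W) v x by rewrite (kin_connect _ _ fT kx) (avoidC _ _ _ fT).
have nxu : x != u by apply: contraTneq exu => <-; rewrite ie.
have nxv : x != v by apply: contraTneq exv => <-; rewrite ie.
have lift (A' : arcs V) a b : Tx :\: edge u v \subset A' ->
    connect (fun p q => avoid Tx W p q && ((p, q) \notin edge v u)) a b ->
    connect (avoid A' W) a b.
  move=> /subsetP sub; apply: connect_sub => p q /andP[/and3P[pW qW pq] npq].
  apply: connect1; rewrite /avoid pW qW; apply: sub; rewrite arcD pq edgeC.
  by rewrite npq.
case: (bridge u (sym_feasible_avoid W fx) vxT) => h.
  have [||||k d] := @kin_swap _ e dhat se ie W T Tx u v x fT kx uv _ _ hx.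
  - by rewrite se.
  - by rewrite eq_sym.
  - right; exists u, x; split; first exact: connect0.
      by apply: lift h; apply: subsetUl.
    by rewrite arcU [X in _ || X]edgeE eqxx orbT.
  - by right; exists u, v; split; rewrite ?connect0 // (avoidC _ _ _ fx).
  by move: vW'; apply/negP/redP; eexists; eauto.
have [||||k d] := @kin_swap _ e dhat se ie W T Tx v u x fT kx vu _ _ hx.
- by rewrite se.
- by rewrite eq_sym.
- right; exists v, x; split; first exact: connect0.
    by apply: lift h; rewrite edgeC; apply: subsetUl.
  by rewrite arcU [X in _ || X]edgeE eqxx orbT.
- by left.
by move: uW'; apply/negP/redP; eexists; eauto.
Qed.

(** The invariant for [W] puts, say, [v] in the component of [x] outside [W].  If [v] is
    outside [W'] then [tri_out] applies to uv; if only [u] is, then it applies to vu;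
    if neither is, then [tri_in] applies, as all trees of the kind of [T1] share the
    edges inside [W']. *)
Let tri' A u v x : kin W' T1 A -> (u, v) \in A -> e x u -> e x v -> x \notin W' ->
  reducible W' T1 x -> connect (avoid T1 W') x u \/ connect (avoid T1 W') x v.
Proof.
move=> kA uvA exu exv xW' rx; apply: contrapT => /not_orP[/negP nxu /negP nxv].
have xW := W'W xW'; have kAW := kinW kA; have fA := kin_feasible kA.
have conn_or : connect (avoid T W) x u \/ connect (avoid T W) x v.
  by case: gT => _ _ _ h; apply: h kAW uvA exu exv xW (red'_red rx).
wlog xv : u v uvA exu exv nxu nxv conn_or / connect (avoid T W) x v.
  move=> wl; case: conn_or => h; last by apply: (wl u v) => //; right.
  by apply: (wl v u) => //; [rewrite (feasibleC _ _ fA) | right].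
have vW := connect_avoid_out xW xv.
have [vW'|vW'] := boolP (v \in W'); last first.
  exact: (tri_out kA uvA exu exv xW' vW' rx xv nxv nxu).
have [uW'|uW'] := boolP (u \in W').
  case: rx => Tx kTx hx; apply: (tri_in kTx hx _ exu exv) => //.
  have kAT : kin W' A Tx.
    apply: kin_trans fA _ kTx; case: kA => _ h1 h2; split => //; exact: fT1.
  by case: kAT => _ h _; apply: (linked_in uW' vW' (feasible_neq ie fA uvA)); apply: h.
have xu : connect (avoid T W) x u.
  apply: connect_trans xv _; rewrite -(kin_connect _ _ fT kAW); apply: connect1.
  by rewrite /avoid vW W'W // (feasibleC _ _ fA).
by apply: (tri_out kA _ exv exu xW' uW' rx xu) => //; rewrite (feasibleC _ _ fA).
Qed.

Lemma good_refine : good W' T1.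
Proof.
split => //.
by move=> w wW' /red'_red /redP; rewrite wW'.
Qed.
End Refine.

(** Starting from the empty set, refine until [W] consists of all irreducible vertices. *)
Lemma good_final T : feasible T ->
  exists W T', good W T' /\ forall v, v \notin W -> reducible W T' v.
Proof.
move=> fT; have g0 : good set0 T.
  have conn a b : connect (avoid T set0) a b.
    have [_ _ cT _ _] := fT; apply: connect_sub (cT a b) => p q pq.
    by apply: connect1; rewrite /avoid !inE.
  split => // [w|A u v x *]; first by rewrite inE.
  by left; apply: conn.
have [n] := ubnP #|~: (set0 : {set V})|.
elim: n (set0 : {set V}) T g0 {fT} => // n IH W T gT hn.
pose W' := [set v | ~~ `[<reducible W T v>]].
have WW' : W \subset W'.
  apply/subsetP => w wW; rewrite inE; apply/negP => /asboolP.
  by case: gT => _ h _ _; apply: h.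
have [eW|neW] := eqVneq W W'.
  by exists W, T; split => // v; rewrite {1}eW inE negbK => /asboolP.
have fT : feasible T by case: gT.
have [T1 kT1 maxT1] := exists_max (num_connected_pairs W') (kin_refl W fT).
apply: (IH W' T1 (good_refine gT kT1 maxT1)); rewrite -ltnS.
apply: leq_trans hn; rewrite ltnS; apply: proper_card.
by rewrite properEneq setCS WW' (inj_eq (inv_inj (@setCK _))) eq_sym neW.
Qed.
End Step.

(** * The final count *)

(** An edge of a cycle could be deleted without disconnecting the graph, which would
    then have too few edges. *)
Lemma tight_acyclic (V : finType) (A : arcs V) :
  symmetric (arc_rel A) -> irreflexive (arc_rel A) ->
  (forall x y, connect (arc_rel A) x y) -> #|A| + 2 <= 2 * #|V| -> acyclic (arc_rel A).
Proof.
move=> sA iA cA cardA [|x [|y [|z p]]] // /andP[/= /and3P[xy yz zp]].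
rewrite !inE !negb_or => /and3P[/and3P[nxy nxz nxp] /andP[nyz nyp] _].
have sB := @sym_rem _ A x y sA.
have yx : connect (arc_rel (A :\: edge x y)) y x.
  apply: (@connect_trans _ _ z).
    apply: connect1; rewrite /arc_rel arcD edgeE !xpair_eqE [(_, _) \in A]yz andbT.
    by rewrite [z == x]eq_sym (negbTE nxz) [y == x]eq_sym (negbTE nxy) andbF.
  elim: p z zp {yz} nxz nyz nxp nyp => [|w p IH] z /=.
    rewrite andbT => zx nxz nyz _ _; apply: connect1.
    rewrite /arc_rel arcD edgeE !xpair_eqE [z == x]eq_sym (negbTE nxz) [z == y]eq_sym.
    by rewrite (negbTE nyz).
  move=> /andP[zw wp] nxz nyz; rewrite !inE !negb_or.
  move=> /andP[nxw nxp] /andP[nyw nyp]; apply: connect_trans (IH w wp nxw nyw nxp nyp).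
  apply: connect1; rewrite /arc_rel arcD edgeE !xpair_eqE [z == x]eq_sym (negbTE nxz).
  by rewrite [z == y]eq_sym (negbTE nyz).
have hB : covers set0 A (A :\: edge x y).
  apply: (covers_swap sB (subxx _)); left; rewrite (sym_connect_sym (sym_avoid _ sB)).
  by apply: connect_sub yx => a b ab; apply: connect1; rewrite /avoid !in_set0.
have := connected_bound sB (covers_connected sB hB cA).
by have := card_rem sA xy nxy; lia.
Qed.

(** An independent set of [t] neighbours of [s] would induce, together with [s], a star. *)
Lemma star_bound (V : finType) (e : rel V) t s (X : {set V}) :
  simple_graph e -> star_free t e -> (forall x, x \in X -> e s x) ->
  (forall x y, x \in X -> y \in X -> ~~ e x y) -> #|X| < t.
Proof.
move=> [se ie] hfree sX indX; rewrite ltnNge; apply/card_geqP => -[l [ul sl lX]].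
have nsl : s \notin l by apply/negP => /lX /sX; rewrite ie.
pose A := [set x in s :: l]; apply: (hfree A).
have sA : s \in A by rewrite !inE eqxx.
have lA (i : 'I_t) : nth s l i \in A by rewrite !inE mem_nth ?orbT // sl.
pose f (x : {x : V | x \in A}) : ('I_1 + 'I_t)%type :=
  if insub (index (val x) l) is Some i then inr i else inl ord0.
pose g (y : ('I_1 + 'I_t)%type) : {x : V | x \in A} :=
  match y with inl _ => exist _ s sA | inr i => exist _ (nth s l i) (lA i) end.
have fs (x : {x : V | x \in A}) : val x = s -> f x = inl ord0.
  move=> xs; rewrite /f xs insubF //; apply/negbTE.
  by rewrite -leqNgt -sl leqNgt index_mem.
have fl (x : {x : V | x \in A}) (lt : index (val x) l < t) : f x = inr (Ordinal lt).
  by rewrite /f insubT.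
have Al (x : {x : V | x \in A}) : val x != s -> val x \in l.
  by have := valP x; rewrite !inE => /orP[/eqP ->|//]; rewrite eqxx.
exists f.
  exists g => [x|[i|i]].
  - apply: val_inj; have [xs|/Al xl] := eqVneq (val x) s; first by rewrite fs.
    have lt : index (val x) l < t by rewrite -sl index_mem.
    by rewrite (fl _ lt) /= nth_index.
  - by rewrite fs // [i]ord1.
  - have lt : index (val (g (inr i))) l < t by rewrite /= index_uniq ?sl.
    by rewrite (fl _ lt); congr inr; apply: val_inj; rewrite /= index_uniq ?sl.
move=> x y; rewrite /induced.
have [xs|/Al xl] := eqVneq (val x) s; have [ys|/Al yl] := eqVneq (val y) s.
- by rewrite !fs // xs ys ie.
- have lty : index (val y) l < t by rewrite -sl index_mem.
  by rewrite fs // (fl _ lty) xs sX // lX.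
- have ltx : index (val x) l < t by rewrite -sl index_mem.
  by rewrite (fl _ ltx) fs // ys se sX // lX.
have lty : index (val y) l < t by rewrite -sl index_mem.
have ltx : index (val x) l < t by rewrite -sl index_mem.
by rewrite (fl _ ltx) (fl _ lty); apply/esym/negbTE/indX; apply: lX.
Qed.

Lemma j_connected_connected (V : finType) (e : rel V) j : 0 < j -> j_connected j e ->
  forall x y, connect e x y.
Proof.
move=> j0 [_ /(_ set0)]; rewrite cards0 => /(_ j0) h x y.
have hV (z : V) : z \in ~: set0 by rewrite !inE.
pose sg z : {z : V | z \in ~: set0} := exist _ z (hV z).
have /connectP[p pp ly] := h (sg x) (sg y).
apply/connectP; exists (map val p); last by rewrite -[x]/(val (sg x)) last_map -ly.
rewrite -[x]/(val (sg x)); elim: p (sg x) pp {ly} => //= z p IH x' /andP[xz /IH ->].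
by rewrite andbT.
Qed.

(** In this section [T] is a spanning tree of the graph [e], and [S] a set of vertices. *)
Section Count.
Variables (V : finType) (e : rel V) (T : arcs V) (S : {set V}).
Hypotheses (gE : simple_graph e) (sT : symmetric (arc_rel T)) (Te : T \subset pairs e).
Hypotheses (cT : forall x y, connect (arc_rel T) x y) (cardT : #|T| + 2 <= 2 * #|V|).

(** [S1] is the set of vertices of [S] with a [T]-neighbour in [S]; [Rt] has one
    representative of each component of T - S. *)
Let S1 := [set s in S | [exists u in S, (s, u) \in T]].
Let Rt := [set v | (v \notin S) && (root (avoid T S) v == v)].
Let csym : connect_sym (avoid T S). Proof. exact/sym_connect_sym/sym_avoid. Qed.

Lemma card_arcs_from : #|[set p in T | p.1 \in S]| = \sum_(s in S) deg T s.
Proof.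
rewrite -sum1_card; under [RHS]eq_bigr do rewrite /deg -sum1_card.
rewrite pair_big_dep /=; apply: eq_bigl => -[a b].
by rewrite !inE /= andbC.
Qed.

(** Apply [forest_bound] to T - S, in which the vertices of [S] are isolated.  The number
    of its arcs is |T| minus twice the sum of the degrees over [S], plus the number of
    arcs inside [S], at most 2|S1| by [spanning_forest]. *)
Lemma component_count :
  2 * (\sum_(s in S) deg T s) + 2 <= 2 * #|S1| + 2 * #|S| + 2 * #|Rt|.
Proof.
have hR := forest_bound (sym_avoid S sT).
have roots : #|[set v | root (avoid T S) v == v]| = #|S| + #|Rt|.
  rewrite -(cardsID S); congr (_ + _); apply: eq_card => v; rewrite !inE //.
  have [vS|//] := boolP (v \in S); last by rewrite andbF.
  by rewrite andbT (connect_avoid_in vS (connect_root _ v)) eqxx.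
have inner : #|T :&: setX S S| <= 2 * #|S1|.
  have [A [_ AT cardA _ hA]] := spanning_forest sT.
  rewrite pairs_arc_rel in AT; have rT := card_roots_connected cT.
  (* A connected tree is its own spanning forest. *)
  have eA : A = T by apply/eqP; rewrite eqEcard AT; lia.
  by have := hA S; rewrite eA.
have from := card_arcs_from.
have to : #|[set p in T | p.2 \in S]| = \sum_(s in S) deg T s.
  rewrite -from -[RHS](card_imset _ (can_inj (@swap_pairK V V))).
  apply: eq_card => -[a b]; rewrite inE /=; apply/andP/imsetP.
    move=> [ab bS]; exists (b, a) => //; rewrite inE /= bS andbT.
    by have := sT b a; rewrite /arc_rel ab.
  move=> [[c d]]; rewrite inE /= => /andP[cd cS] [-> ->]; split => //.
  by have := sT d c; rewrite /arc_rel cd.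
set X1 := [set p in T | p.1 \in S] in from *; set X2 := [set p in T | p.2 \in S] in to *.
have e1 : #|T| = #|X1 :|: X2| + #|pairs (avoid T S)|.
  rewrite -(cardsID (X1 :|: X2) T) (_ : T :&: _ = X1 :|: X2); last first.
    by apply/setP => p; rewrite !inE; case: (p \in T).
  congr (_ + _); apply: eq_card => -[a b]; rewrite !inE /= /avoid.
  by case: (a \in S); case: (b \in S); case: (_ \in T).
have e2 := cardsUI X1 X2.
have e3 : X1 :&: X2 = T :&: setX S S.
  by apply/setP => -[a b]; rewrite !inE /=; case: (_ \in T).
rewrite e3 in e2; lia.
Qed.

Hypothesis outside : forall x y, x \notin S -> y \notin S -> e x y ->
  connect (avoid T S) x y.

(** The vertices of [S] with a G-neighbour in the component of [r]. *)
Let N r := [set s in S | [exists x, connect (avoid T S) r x && e x s]].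

(** Deleting the neighbours of a component in [S] separates it from the others. *)
Lemma neighbours_bound j r : j_connected j e -> 1 < #|Rt| -> r \in Rt -> j <= #|N r|.
Proof.
move=> [_ jc] cRt rRt; rewrite leqNgt; apply/negP => /jc cN.
have [r' r'Rt nr] : exists2 r', r' \in Rt & r' != r.
  have : 0 < #|Rt :\ r| by rewrite (cardsD1 r) rRt in cRt.
  by move=> /card_gt0P[r']; rewrite inE inE => /andP[h1 h2]; exists r'.
move: rRt r'Rt; rewrite !inE => /andP[rS /eqP rr] /andP[r'S /eqP rr'].
have rN z : z \notin S -> z \in ~: N r by rewrite !inE => /negbTE ->.
pose a := [pred z : {x | x \in ~: N r} | connect (avoid T S) r (val z)].
have sI : symmetric (@induced V e (~: N r)) by move=> x y; apply: (proj1 gE).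
have cla : closed (@induced V e (~: N r)) a.
  apply: (intro_closed (sym_connect_sym sI)) => x y exy; rewrite !inE => rx.
  have xS : val x \notin S := connect_avoid_out rS rx.
  have [yS|yS] := boolP (val y \in S); last exact: connect_trans rx (outside xS yS exy).
  have := valP y; rewrite !inE yS /= => /negP[]; apply/existsP.
  by exists (val x); rewrite rx.
have := closed_connect cla (cN (exist _ r (rN _ rS)) (exist _ r' (rN _ r'S))).
rewrite !inE /= connect0 => /esym/(fingraph.rootP csym) err.
by rewrite -rr -rr' err eqxx in nr.
Qed.

Hypothesis tri : forall u v x, (u, v) \in T -> e x u -> e x v -> x \notin S ->
  connect (avoid T S) x u \/ connect (avoid T S) x v.

(** One neighbour of [s] in each component adjacent to [s], together with a
    [T]-neighbour of [s] in [S] if there is one, form an independent set. *)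
Lemma star_count t s : star_free t e -> s \in S ->
  #|[set r in Rt | s \in N r]| + (s \in S1) < t.
Proof.
move=> hfree sS; set Q := [set r in Rt | _].
have hQ r : r \in Q -> exists x, connect (avoid T S) r x && e x s.
  by rewrite !inE => /andP[_ /andP[_ /existsP]].
pose f r := odflt r [pick x | connect (avoid T S) r x && e x s].
have fP r : r \in Q -> connect (avoid T S) r (f r) && e (f r) s.
  by move=> /hQ[x hx]; rewrite /f; case: pickP => [//|/(_ x)]; rewrite hx.
have QS r : r \in Q -> r \notin S /\ root (avoid T S) r = r.
  by rewrite !inE => /andP[/andP[h /eqP ->]].
have fS r : r \in Q -> f r \notin S.
  move=> rQ; have /andP[h _] := fP r rQ; apply: connect_avoid_out h.
  by case: (QS r rQ).
have fconn r r' : r \in Q -> r' \in Q -> connect (avoid T S) (f r) (f r') -> r = r'.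
  move=> rQ r'Q ff; have [_ <-] := QS r rQ; have [_ <-] := QS r' r'Q.
  apply/(fingraph.rootP csym).
  have /andP[h _] := fP r rQ; have /andP[h' _] := fP r' r'Q.
  by apply: connect_trans h (connect_trans ff _); rewrite csym.
have cf : #|f @: Q| = #|Q|.
  by apply: card_in_imset => r r' rQ r'Q eff; apply: fconn; rewrite // eff connect0.
have [se ie] := gE.
have fX x : x \in f @: Q -> [/\ x \notin S, e x s & exists2 r, r \in Q & x = f r].
  case/imsetP => r rQ ->; split; [exact: fS | by case/andP: (fP r rQ) | by exists r].
have indf x y : x \in f @: Q -> y \in f @: Q -> ~~ e x y.
  move=> /fX[xS xs [r rQ ex]] /fX[yS ys [r' r'Q ey]]; apply/negP => exy.
  have := outside xS yS exy; rewrite ex ey => /(fconn _ _ rQ r'Q) err.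
  by move: exy; rewrite ex ey err ie.
have [|sS1] := boolP (s \in S1); last first.
  rewrite addn0 -cf; apply: (star_bound gE hfree (s := s)) => // x /fX[_ h _].
  by rewrite se.
rewrite inE => /andP[_ /existsP[u /andP[uS su]]].
have uf : u \notin f @: Q by apply/negP => /fX[]; rewrite uS.
have esu : e s u by have := subsetP Te _ su; rewrite inE.
have nfu x : x \in f @: Q -> ~~ e x u.
  move=> /fX[xS xs _]; apply/negP => xu.
  by case: (tri su xs xu xS) => /(connect_avoid_out xS); rewrite ?sS ?uS.
rewrite addn1 -cf (_ : #|f @: Q|.+1 = #|u |: f @: Q|); last by rewrite cardsU1 uf.
apply: (star_bound gE hfree (s := s)) => [x|x y].
  by rewrite in_setU1 => /orP[/eqP -> //|/fX[_ h _]]; rewrite se.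
rewrite !in_setU1 => /orP[/eqP ->|xf] /orP[/eqP ->|yf]; rewrite ?ie //.
- by rewrite se nfu.
- exact: nfu.
- exact: indf.
Qed.

(** Double counting of the adjacencies between [S] and the components of T - S; the
    degree of the tree that is sought is k + 2 here. *)
Lemma final_count j k t : 0 < j -> t = j * k + 2 -> j_connected j e -> star_free t e ->
  (k + 2) * #|S| < \sum_(s in S) deg T s -> False.
Proof.
move=> j0 et jc hfree hdeg.
have hcomp := component_count.
have S1S : #|S1| <= #|S| by apply/subset_leq_card/subsetP => s; rewrite inE => /andP[].
have cRt : k * #|S| + (#|S| - #|S1|) + 2 <= #|Rt| by lia.
have h1 : j * #|Rt| <= \sum_(r in Rt) #|N r|.
  rewrite mulnC -sum_nat_const; apply: leq_sum => r; apply: neighbours_bound jc _.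
  by lia.
have h2 : \sum_(r in Rt) #|N r| = \sum_(s in S) #|[set r in Rt | s \in N r]|.
  under eq_bigr do rewrite -sum1_card.
  under [RHS]eq_bigr do rewrite -sum1_card.
  rewrite (exchange_big_dep (mem S)) /=; last by move=> r s _; rewrite inE => /andP[].
  apply: eq_bigr => s _; apply: eq_bigl => r.
  by rewrite [in RHS]inE.
have h3 : \sum_(s in S) (#|[set r in Rt | s \in N r]| + (s \in S1)) <=
    #|S| * (j * k + 1).
  rewrite -sum_nat_const; apply: leq_sum => s sS.
  by have := star_count hfree sS; rewrite et; lia.
have h4 : \sum_(s in S) (s \in S1 : nat) = #|S1|.
  rewrite -sum1_card big_mkcond [RHS]big_mkcond /=; apply: eq_bigr => s _.
  have : s \in S1 -> s \in S by rewrite inE => /andP[].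
  by case: (s \in S1); case: (s \in S) => // /(_ isT).
rewrite big_split /= h4 -h2 in h3.
have h5 : j * (k * #|S| + (#|S| - #|S1|) + 2) <= #|S| * (j * k + 1) - #|S1|.
  apply: leq_trans (leq_trans _ h1) _; first by rewrite leq_mul2l cRt orbT.
  by lia.
have h6 : #|S| - #|S1| <= j * (#|S| - #|S1|) by apply: leq_pmull.
move: h5; rewrite !mulnDr mulnA mulnC; lia.
Qed.
End Count.

(** The dichotomy for a spanning tree [T0] of minimal excess.  If it is not a k-tree, then
    with dhat(v) = max(k, d_T0(v)) a vertex of larger dhat than k cannot be
    reducible, so it is in the final set [W]. *)
Lemma tree_or_excess (V : finType) (e : rel V) k : simple_graph e ->
  (forall x y, connect e x y) -> 0 < #|V| ->
  (exists T, k_tree k e T) \/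
  exists W T, [/\
    exists dhat, good e dhat W T /\ forall v, v \notin W -> reducible e dhat W T v &
    k * #|W| < \sum_(w in W) deg T w].
Proof.
move=> [se ie] ce V0.
pose sp A := [/\ symmetric (arc_rel A), A \subset pairs e,
  forall x y, connect (arc_rel A) x y & #|A| + 2 <= 2 * #|V|].
pose exc (A : arcs V) := \sum_v (deg A v - k).
have [A0 sp0] : exists A, sp A.
  have [A [sA Ae cardA cA _]] := spanning_forest se; exists A; split => //.
    by move=> x y; apply: cA.
  have /card_gt0P[x _] := V0.
  suff : 0 < #|[set v | root e v == v]| by lia.
  by apply/card_gt0P; exists (root e x); rewrite inE root_root //; apply: sym_connect_sym.
have [T0 spT0 minT0] : exists2 A, sp A & forall B, sp B -> exc A <= exc B.
  have h0 : `[<sp A0>] by apply/asboolP.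
  case: (@arg_minnP _ A0 (fun A => `[<sp A>]) exc h0) => A /asboolP spA hA.
  by exists A => // B spB; apply: hA; apply/asboolP.
have [s0 e0 c0 n0] := spT0.
have [hle|] := boolP [forall v, deg T0 v <= k].
  left; exists (arc_rel T0); split; last by move=> v; apply: (forallP hle).
    have i0 : irreflexive (arc_rel T0).
      move=> x; apply/negbTE/negP => /(subsetP e0); rewrite inE /= ie //.
    by split => //; apply: tight_acyclic.
  by move=> x y /(subsetP e0); rewrite inE.
rewrite negb_forall => /existsP[w0]; rewrite -ltnNge => hw0; right.
pose dhat v := maxn k (deg T0 v).
have f0 : feasible e dhat T0 by split => // v; apply: leq_maxr.
have [W [T [gT hred]]] := good_final se ie f0.
exists W, T; split; first by exists dhat.
have [fT sat _ _] := gT.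
have dT w : w \in W -> dhat w <= deg T w.
  move=> /sat nr; rewrite leqNgt; apply/negP => h; apply: nr.
  by exists T => //; apply: kin_refl.
(* A tree reducing the degree at [w0] would have smaller excess than [T0]. *)
have w0W : w0 \in W.
  apply/negPn/negP => /hred [A [[sA Ae cA nA dA] _ _] hA].
  have spA : sp A by [].
  have := minT0 A spA; rewrite leqNgt => /negP; apply.
  rewrite /exc (bigD1 w0) //= [X in _ < X](bigD1 w0) //= -addSn; apply: leq_add.
    by move: hA; rewrite /dhat; lia.
  by apply: leq_sum => v _; have := dA v; rewrite /dhat; lia.
rewrite (bigD1 w0) //= (cardsD1 w0) w0W mulnDr muln1 -addSn; apply: leq_add.
  by have := dT w0 w0W; rewrite /dhat; lia.
rewrite mulnC -sum_nat_const.
rewrite (eq_bigl (fun v => (v \in W) && (v != w0))); last first.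
  by move=> v; rewrite !inE andbC.
by apply: leq_sum => v /andP[/dT + _]; rewrite /dhat; lia.
Qed.

Theorem theorem6 (j k t : nat) (V : finType) (e : rel V)
    (hj : 1 <= j) (hk : j <= k)
    (ht : (t%:Z = j%:Z * (k%:Z - 2) + 2)%R)
    (hG : simple_graph e)
    (hconn : j_connected j e)
    (hfree : star_free t e) :
  exists T : rel V, k_tree k e T.
Proof.
have ce := j_connected_connected hj hconn.
have V0 : 1 < #|V| by case: hconn => + _; lia.
have [k1|k2] := leqP k 1.
  (* Here j = k = t = 1, and any edge is an induced K_{1,1}. *)
  have et : t = 1.
    have [ej ek] : j = 1 /\ k = 1 by lia.
    by subst j k; lia.
  have /card_gt1P[x [y [_ _ nxy]]] := V0.
  have /connectP[[|z p] /= + ey] := ce x y; first by rewrite ey eqxx in nxy.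
  move=> /andP[xz _]; have [_ ie] := hG; rewrite et in hfree.
  have : #|[set z]| < 1; last by rewrite cards1.
  apply: (star_bound hG hfree (s := x)) => [u|u v]; rewrite !inE => /eqP -> //.
  by move=> /eqP ->; rewrite ie.
have et : t = j * (k - 2) + 2.
  by apply/eqP; rewrite -eqz_nat PoszD PoszM ht -subzn.
case: (tree_or_excess k hG ce (ltnW V0)) => // -[W [T [[dhat [gT hred]] hdeg]]].
exfalso; have [[sT Te cT nT _] _ cross tri] := gT.
apply: (@final_count V e T W hG sT Te cT nT _ _ j (k - 2) t hj et hconn hfree).
- by move=> x y xW yW exy; apply: cross => //; apply: hred.
- move=> u v x uv xu xv xW; apply: tri (uv) xu xv xW (hred _ xW).
  by apply: kin_refl; case: gT.
- by rewrite subnK.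
Qed.
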